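(* Let $n\ge 2$, let $d\geq 0$ be an even integer, and let $C$ be an $n\times n$ circulant matrix with generator $(c_0,\ldots,c_{n-1})$ such that $c_0=d$, $c_j\in\{1,-1\}$ for $j=1,\ldots,n-1$, and $CC^T=(d^2+n-1)I$. Then $n=2(d+1)$.
   Context: A circulant matrix of order $n$ with generator $(c_0,c_1,\ldots,c_{n-1})$ is the $n\times n$ matrix whose entry in row $i$ and column $j$ (indices $0,\ldots,n-1$) is $c_{(j-i)\bmod n}$. *)

(* Defs.v *)
From mathcomp Require Import all_boot all_order all_algebra.
Set Implicit Arguments.
Unset Strict Implicit.
Unset Printing Implicit Defensive.
Import GRing.Theory.
Local Open Scope ring_scope.

(* Since i < n, the natural number j + n - i is a nonnegative representative
   of the integer j - i modulo n. *)
Definition circulant (R : nzRingType) (n : nat) (c : n.-tuple R) : 'M[R]_n :=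
  \matrix_(i < n, j < n) c`_((j + n - i) %% n)%N.

(* Main.v *)
Require Import Defs.
From mathcomp Require Import all_boot all_order all_algebra.
From mathcomp Require Import zify ring.
Set Implicit Arguments.
Unset Strict Implicit.
Unset Printing Implicit Defensive.
Import GRing.Theory.
Local Open Scope ring_scope.

(* Index the generator by Z/n. Reducing the s-th autocorrelation modulo 4 gives
   n = 3 - c_s c_(-s) (mod 4) for every s <> 0. Hence n is even, and s = n/2
   forces n = 2 (mod 4), so c_(-s) = c_s for all s. By this symmetry, the
   autocorrelation at an odd s is twice the sum of c_j c_(s-j) over even j.
   As c_j is odd for even j <> 0 while c_0 = d is even, subtracting two such
   relations modulo 4 shows that c is constant, equal to some e = 1 or -1, on
   the odd residues. Consequently c sums to 0 over the even residues and to
   e n/2 over Z/n, so that (n/2)^2 = d^2 + n - 1, i.e. (n/2 - 1)^2 = d^2. *)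

Lemma prod_sign (I : finType) (P : pred I) (f : I -> int) :
  (forall i, P i -> f i = 1 \/ f i = -1) ->
  \prod_(i | P i) f i = 1 \/ \prod_(i | P i) f i = -1.
Proof.
move=> hf; apply: (big_ind (fun x => x = 1 \/ x = -1)) => //; first by left.
by move=> x y [->|->] [->|->]; [left|right|right|left].
Qed.

(* On signs, x |-> x - 1 turns products into sums modulo 4, because
   (x y - 1) - (x - 1) - (y - 1) = (x - 1) (y - 1). *)
Lemma sum_sign_mod4 (I : finType) (P : pred I) (f : I -> int) :
  (forall i, P i -> f i = 1 \/ f i = -1) ->
  exists q, \sum_(i | P i) f i = #|P|%:Z + \prod_(i | P i) f i - 1 + 4 * q.
Proof.
move=> hf; rewrite -sum1_card.
(* The invariant records that the partial product is a sign, since the congruence modulo 4 passes to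
   the next factor only for signs. *)
pose K (s : int) (m : nat) (p : int) :=
  (p = 1 \/ p = -1) /\ exists q, s = m%:Z + p - 1 + 4 * q.
suff [] : K (\sum_(i | P i) f i) (\sum_(i in P) 1)%N (\prod_(i | P i) f i) by [].
apply: (big_rec3 K) => [|i s m p Pi [hp [q ->]]]; first by split; [left|exists 0].
rewrite /K PoszD; case: (hf i Pi) hp => -> [->|->].
- by split; [left|exists q; ring].
- by split; [right|exists q; ring].
- by split; [right|exists q; ring].
- by split; [left|exists (q - 1); ring].
Qed.

Section CyclicSequence.

Variables (k d : nat) (a : 'I_k.+2 -> int).
Hypotheses (d_even : ~~ odd d) (a0 : a 0 = d%:Z).
Hypothesis a_sign : forall x, x != 0 -> a x = 1 \/ a x = -1.
Hypothesis a_corr : forall s, s != 0 -> \sum_j a j * a (j - s) = 0.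

(** In the autocorrelation at [s], the terms [j = 0] and [j = s] give [d * (a s + a (- s))], a
    multiple of 4. The other [k] terms are signs, so their sum modulo 4 is determined by their
    product. *)
Lemma order_mod4 s : s != 0 -> exists q, k.+2%:Z = 3 - a s * a (- s) + 4 * q.
Proof.
move=> s0.
pose P := [pred j : 'I_k.+2 | (j != 0) && (j != s)].
have cardP : #|P| = k.
  have /= := cardC (pred2 0 s); rewrite card2 eq_sym s0 card_ord.
  rewrite (@eq_card _ _ P); last by move=> j; rewrite !inE negb_or.
  by move=> [].
have fP j : P j -> a j * a (j - s) = 1 \/ a j * a (j - s) = -1.
  case/andP=> j0 js.
  have [->|->] := a_sign j0; have [|->|->] := @a_sign (j - s); rewrite ?subr_eq0 //; lia.
have := a_corr s0; rewrite (bigD1 0) //= (bigD1 s) //= sub0r subrr a0 => corr.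
have [q] := sum_sign_mod4 fP; rewrite cardP => sumP.
(* A sign is its own inverse, so deleting [a x] from the product amounts to multiplying by it. *)
have Qs x : x != 0 -> \prod_(j | (j != 0) && (j != x)) a j = a x * \prod_(j | j != 0) a j.
  move=> x0; rewrite [in RHS](bigD1 x) //= mulrA.
  by have [->|->] := a_sign x0; rewrite ?mulrNN ?mul1r.
have shift_prod : \prod_(j | P j) a (j - s) = a (- s) * \prod_(j | j != 0) a j.
  rewrite -Qs ?oppr_eq0 // (reindex_inj (addIr s)) /=.
  apply: eq_big => j; last by rewrite addrK.
  by rewrite /= addr_eq0 -[j + s == s]subr_eq0 addrK andbC.
(* The full product over nonzero indices occurs twice and squares to 1. *)
have prodP : \prod_(j | P j) (a j * a (j - s)) = a s * a (- s).
  rewrite big_split /= Qs // shift_prod mulrACA.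
  by have [->|->] := @prod_sign _ (fun j => j != 0) a a_sign; rewrite ?mulrNN mulr1.
move: sumP; rewrite prodP.
have dE : d%:Z = 2 * (d./2)%:Z by lia.
have [e eE] : exists e, a s + a (- s) = 2 * e.
  have [->|->] := a_sign s0; have [|->|->] := @a_sign (- s); rewrite ?oppr_eq0 //;
  by [exists 1|exists 0|exists (-1)].
have -> : \sum_(j | P j) a j * a (j - s) = - (4 * ((d./2)%:Z * e)).
  apply/eqP; rewrite -addr_eq0 -[X in _ == X]corr; apply/eqP.
  have -> : 4 * ((d./2)%:Z * e) = d%:Z * (a s + a (- s)) by rewrite dE eE; ring.
  by rewrite /=; ring.
by move=> h; exists (- ((d./2)%:Z * e) - q); lia.
Qed.

Lemma order_even : ~~ odd k.+2.
Proof.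
have [//|q] := @order_mod4 1.
have [//|->|->] := @a_sign 1; have [|->|->] := @a_sign (-1); rewrite ?oppr_eq0 //; lia.
Qed.

Lemma a_opp x : a (- x) = a x.
Proof.
have [->|x0] := eqVneq x 0; first by rewrite oppr0.
pose h : 'I_k.+2 := inord (k.+2)./2.
have hE : (h : nat) = (k.+2)./2 by rewrite inordK //; lia.
have h0 : h != 0 by apply/eqP => /(congr1 val) /=; lia.
have hN : - h = h.
  by apply/val_inj; rewrite /= hE modn_small; have := order_even; lia.
(* Since [- h = h], the product at [h] is a square; comparison modulo 4 then excludes the product -1
   at [x]. *)
have [q] := order_mod4 h0; have [r] := order_mod4 x0; rewrite hN.
have [->|->] := a_sign h0; have [->|->] := a_sign x0;
  have [|->|->] := @a_sign (- x); rewrite ?oppr_eq0 //; lia.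
Qed.

Lemma odd_ordB (x y : 'I_k.+2) : odd (x - y)%R = odd x (+) odd y.
Proof.
have ne := negbTE order_even.
by rewrite /= odd_mod // oddD odd_mod // oddB ?ne // ltnW.
Qed.

Lemma sum_odd_even (s : 'I_k.+2) (F : 'I_k.+2 -> int) : odd s ->
  \sum_(j : 'I_k.+2 | odd j) F j = \sum_(j : 'I_k.+2 | ~~ odd j) F (s - j).
Proof.
move=> so; rewrite (reindex_inj (subrI s)) /=.
by apply: eq_bigl => j; rewrite odd_ordB so.
Qed.

(** The reflection [j |-> s - j] swaps the parity classes and preserves the summand, so the
    autocorrelation is twice this sum. *)
Lemma even_corr (s : 'I_k.+2) : odd s -> \sum_(j : 'I_k.+2 | ~~ odd j) a j * a (s - j) = 0.
Proof.
move=> so; have s0 : s != 0 by apply: contraTneq so => ->.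
have := a_corr s0.
under eq_bigr => j _ do rewrite -(a_opp (j - s)) opprB.
rewrite (bigID (fun j : 'I_k.+2 => odd j)) /=.
have -> : \sum_(j : 'I_k.+2 | odd j) a j * a (s - j) =
          \sum_(j : 'I_k.+2 | ~~ odd j) a j * a (s - j).
  by rewrite (sum_odd_even _ so); apply: eq_bigr => j _; rewrite subKr mulrC.
have double_eq0 (x : int) : x + x = 0 -> x = 0 by lia.
exact: double_eq0.
Qed.

Lemma a_odd_const (s t : 'I_k.+2) : odd s -> odd t -> a s = a t.
Proof.
move=> so to.
have s0 : s != 0 by apply: contraTneq so => ->.
have t0 : t != 0 by apply: contraTneq to => ->.
(* Subtracting 1 is harmless, as both [a (s - j)] and [a (t - j)] run over all odd entries. It makes
   each term with [j != 0] a product of two even factors. *)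
have : \sum_(j : 'I_k.+2 | ~~ odd j) (a j - 1) * (a (s - j) - a (t - j)) = 0.
  under eq_bigr => j _ do rewrite mulrBl mul1r mulrBr.
  by rewrite !sumrB !even_corr // -!sum_odd_even // !subrr.
rewrite (bigD1 0) //= !subr0 a0.
set S := \sum_(_ | _) _.
have [q ->] : exists q, S = 4 * q.
  rewrite {}/S; apply: (big_ind (fun x => exists q, x = 4 * q))
    => [|x y [q ->] [r ->]|j /andP[jo j0]].
  - by exists 0.
  - by exists (q + r); ring.
  have sj0 : s - j != 0 by rewrite subr_eq0; apply: contraTneq so => ->.
  have tj0 : t - j != 0 by rewrite subr_eq0; apply: contraTneq to => ->.
  have [->|->] := a_sign j0; have [->|->] := a_sign sj0; have [->|->] := a_sign tj0;
  by [exists 0|exists 1|exists (-1)].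
(* Now 4 divides [(d - 1) * (a s - a t)] with [d - 1] odd, which rules out a difference of 2 or
   -2. *)
have [->|->] := a_sign s0; have [->|->] := a_sign t0; lia.
Qed.

(** For fixed [j], the index [j - s] runs over Z/n along with [s], so the double sum factors. *)
Lemma sum_corr : \sum_s \sum_j a j * a (j - s) = (\sum_j a j) ^+ 2.
Proof.
rewrite exchange_big /= expr2 mulr_suml; apply: eq_bigr => j _.
by rewrite -mulr_sumr [in RHS](reindex_inj (subrI j)).
Qed.

Lemma order_eq : \sum_j a j * a j = d%:Z ^+ 2 + k.+2%:Z - 1 -> k.+2 = (2 * (d + 1))%N.
Proof.
move=> norm.
have o1 : odd (1%R : 'I_k.+2) by [].
have sum_odd : \sum_(j : 'I_k.+2 | odd j) a j = a 1 * \sum_(j : 'I_k.+2 | odd j) 1.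
  by rewrite mulr_sumr; apply: eq_bigr => j jo; rewrite mulr1; apply: a_odd_const.
have sum_even : \sum_(j : 'I_k.+2 | ~~ odd j) a j = 0.
  have := even_corr o1; rewrite (eq_bigr (fun j => a j * a 1)); last first.
    by move=> j jo; congr (_ * _); apply: a_odd_const; rewrite ?odd_ordB ?o1.
  rewrite -mulr_suml => /eqP; rewrite mulf_eq0 => /orP[/eqP //|].
  by have [//|->|->] := @a_sign 1.
have card_odd : k.+2%:Z = 2 * \sum_(j : 'I_k.+2 | odd j) 1.
  have : \sum_(j : 'I_k.+2) 1 = k.+2%:Z by rewrite sumr_const card_ord natz.
  rewrite (bigID (fun j : 'I_k.+2 => odd j)) /= -(sum_odd_even (fun=> 1) o1) => <-.
  by rewrite mulr_natl mulr2n.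
have := sum_corr; rewrite (bigD1 0) //= [X in _ + X]big1 ?addr0; last first.
  by move=> s s0; apply: a_corr.
under eq_bigr => j _ do rewrite subr0.
rewrite norm (bigID (fun j : 'I_k.+2 => odd j)) /= sum_even addr0 sum_odd.
move: card_odd; set u := \sum_(_ | _) 1 => nu.
rewrite exprMn; have -> : a 1 ^+ 2 = 1 by have [//|->|->] := @a_sign 1.
rewrite nu mul1r => sq.
have /eqP : (u - 1 - d%:Z) * (u - 1 + d%:Z) = 0.
  by apply/eqP; rewrite -(inj_eq (addrI (d%:Z ^+ 2 + 2 * u - 1))) {2}sq; apply/eqP; ring.
(* The root [u - 1 = - d] is possible only for [d = 0] and [u = 1], which also satisfies the
   claim. *)
rewrite mulf_eq0 => /orP[] /eqP; lia.
Qed.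

End CyclicSequence.

Theorem theorem3p8 (n d : nat) (c : n.-tuple int) (C : 'M[int]_n)
    (hn : (2 <= n)%N) (hd : ~~ odd d)
    (hC : C = circulant c)
    (hc0 : c`_0 = d%:Z)
    (hc : forall j : nat, (1 <= j <= n - 1)%N -> c`_j = 1 \/ c`_j = -1)
    (hCCT : C *m C^T = (d%:Z ^+ 2 + n%:Z - 1)%:M) :
  n = (2 * (d + 1))%N.
Proof.
case: n hn c C hC hc0 hc hCCT => [|[|k]] // _ c C -> c0 hc CCT.
pose a (x : 'I_k.+2) : int := c`_x.
(* Row [s] of the circulant is row 0 shifted by [s], so entry [(0, s)] of [C *m C^T] is the
   autocorrelation at [s]. *)
have corr s : \sum_j a j * a (j - s) = (d%:Z ^+ 2 + k.+2%:Z - 1) *+ (s == 0).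
  have := congr1 (fun M : 'M_k.+2 => M 0 s) CCT; rewrite !mxE eq_sym => <-.
  apply: eq_bigr => j _; rewrite !mxE /a /=; congr (c`_ _ * c`_ _).
    by rewrite subn0 modnDr modn_small.
  by rewrite modnDmr addnBA // ltnW.
apply: (@order_eq k d a) => //.
- by move=> x x0; apply: hc; move: x0; rewrite -val_eqE /=; have := ltn_ord x; lia.
- by move=> s /negbTE s0; rewrite corr s0.
- by have := corr 0; rewrite eqxx mulr1n => <-; apply: eq_bigr => j _; rewrite subr0.
Qed.
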